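(* In each of the following seven cases, $P_1\leq_{\mathrm{st}}P_2$ holds if and only if the stated tail condition(s) hold. (a) (Binomial) Let $P_i=b_{n_i,p_i}$ with $p_i\in(0,1)$, $n_i\in\mathbb N$, $i=1,2$. Then $P_1\leq_{\mathrm{st}}P_2$ if and only if $(1-p_1)^{n_1}\geq(1-p_2)^{n_2}$ (left tail condition) and $n_1\leq n_2$ (right tail condition). (b) (Negative binomial) Let $P_i=b^-_{r_i,p_i}$ with $r_i>0$, $p_i\in(0,1]$, $i=1,2$. Then $P_1\leq_{\mathrm{st}}P_2$ if and only if $p_1^{r_1}\geq p_2^{r_2}$ (left tail condition) and $p_1\geq p_2$ (right tail condition). (c) (Hypergeometric) Let $P_i=\mathrm{hyp}_{B_i,W_i,n_i}$ with $B_i,W_i,n_i\in\mathbb N_0$, $B_i+W_i\geq n_i\geq1$, $i=1,2$. Assume that $$B_2+W_2\geq B_1+W_1\qquad\text{or}\qquad \{n_1,\,B_1,\,n_2-W_2-1\}\cap\{n_2,\,B_2,\,n_1-W_1-1\}\neq\emptyset .$$ Put $k_*=(n_1-W_1)^+\wedge(n_2-W_2)^+$ and $k^*=(n_1\wedge B_1)\vee(n_2\wedge B_2)$. Then $P_1\leq_{\mathrm{st}}P_2$ if and only if $\mathrm{hyp}_{B_1,W_1,n_1}(\{k_*\})\geq\mathrm{hyp}_{B_2,W_2,n_2}(\{k_*\})$ (left tail condition) and $\mathrm{hyp}_{B_1,W_1,n_1}(\{k^*\})\leq\mathrm{hyp}_{B_2,W_2,n_2}(\{k^*\})$ (right tail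 condition). (d) (Hypergeometric versus binomial) Let $P_1=\mathrm{hyp}_{B,W,m}$ and $P_2=b_{n,p}$ with $B,W,m,n\in\mathbb N$, $B+W\geq m$, $p\in(0,1]$. Then $P_1\leq_{\mathrm{st}}P_2$ if and only if $\binom{W}{m}\big/\binom{B+W}{m}\geq(1-p)^n$ (left tail condition) and $m\wedge B\leq n$ (right tail condition). (e) (Binomial versus hypergeometric) Let $P_1=b_{m,p}$ and $P_2=\mathrm{hyp}_{B,W,m}$ with $B,W,m\in\mathbb N_0$, $B+W\geq m\geq1$, $p\in[0,1]$. Then $P_1\leq_{\mathrm{st}}P_2$ if and only if $p^m\leq\binom{B}{m}\big/\binom{B+W}{m}$ (right tail condition). (The left tail condition $P_1(\{k_*\})\geq P_2(\{k_*\})$, where $k_*$ is the minimum of the support of $P_1+P_2$, is implied by this right tail condition.) (f) (Binomial versus Poisson) Let $P_1=b_{n,p}$ and $P_2=\mathrm{Poi}_\lambda$ with $n\in\mathbb N$, $p\in[0,1]$, $\lambda>0$. Then $P_1\leq_{\mathrm{st}}P_2$ if and only if $(1-p)^n\geq e^{-\lambda}$ (left tail condition). (The right tail condition $\limsup_{k\to\infty}P_1(\{k\})/P_2(\{k\})\leq1$ is always fulfilled.) (g) (Poisson versus negative binomial) Let $P_1=\mathrm{Poi}_\lambda$ and $P_2=b^-_{r,p}$ with $p\in(0,1)$ and $r,\lambda>0$. Then $P_1\leq_{\mathrm{st}}P_2$ if and only if $e^{-\lambda}\geq p^r$ (left tail condition). (The right tail condition $\limsup_{k\to\infty}P_1(\{k\})/P_2(\{k\})\leq1$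 is always fulfilled.)
   Context: $\mathbb N=\{1,2,\ldots\}$, $\mathbb N_0=\{0,1,2,\ldots\}$; $x\wedge y=\min(x,y)$, $x\vee y=\max(x,y)$, $x^+=\max(x,0)$. Stochastic order: for probability measures $P,Q$ on $\mathbb R$, $P\leq_{\mathrm{st}}Q$ means $P([x,\infty))\leq Q([x,\infty))$ for all $x\in\mathbb R$. Distributions (all regarded as probability measures on $\mathbb N_0$): - $b_{n,p}$ is the binomial distribution with parameters $n\in\mathbb N$, $p\in[0,1]$. - $b^-_{r,p}$ is the negative binomial distribution with parameters $r\in(0,\infty)$, $p\in(0,1]$: $b^-_{r,p}(\{k\})=\binom{r+k-1}{k}p^r(1-p)^k$ for $k\in\mathbb N_0$, where $\binom{r+k-1}{k}=\frac{r(r+1)\cdots(r+k-1)}{k!}$ (and $0^0=1$). - $\mathrm{Poi}_\lambda$ is the Poisson distribution with parameter $\lambda>0$. - $\mathrm{hyp}_{B,W,n}$ is the hypergeometric distribution with parameters $B,W\in\mathbb N_0$, $n\in\mathbb N$, $n\leq B+W$: $\mathrm{hyp}_{B,W,n}(\{k\})=\binom Bk\binom W{n-k}\big/\binom{B+W}{n}$ for $k=(n-W)^+,\ldots,B\wedge n$, and $0$ for all other $k$. For $a,k\in\mathbb N_0$ the usual convention $\binom ak=0$ for $k>a$ is used. *)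

(* Defs.v *)
From HB Require Import structures.
From mathcomp Require Import all_boot all_order all_algebra.
From mathcomp Require Import all_classical all_reals all_analysis.
From mathcomp Require Import ring lra.
Set Implicit Arguments.
Unset Strict Implicit.
Unset Printing Implicit Defensive.
Import Order.TTheory GRing.Theory Num.Theory.
Import numFieldNormedType.Exports.
Local Open Scope classical_set_scope.
Local Open Scope ring_scope.

Definition st_le {R : realType} (P Q : probability R R) : Prop :=
  forall x : R, (P `[x, +oo[%classic <= Q `[x, +oo[%classic)%E.

Definition nat_inclusion (R : realType) (k : nat) : R := k%:R.

Lemma measurable_nat_inclusion (R : realType) :
  measurable_fun [set: nat] (@nat_inclusion R).
Proof. by []. Qed.

HB.instance Definition _ (R : realType) :=
  isMeasurableFun.Build _ _ _ _ (@nat_inclusion R) (@measurable_nat_inclusion R).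

(* A law on the natural numbers, regarded as a law on the real line. *)
Definition real_law {R : realType} (P : probability nat R) :
    probability R R :=
  distribution P (@nat_inclusion R).

Definition law_support {R : realType} (mu : set nat -> \bar R) : set nat :=
  [set k | (0 < mu [set k])%E].

Definition is_least (A : set nat) (k : nat) : Prop := A k /\ lbound A k.

Section hypergeometric.
Context {R : realType} (B W n : nat).

Definition hypergeometric_pmf (k : nat) : R :=
  if (n - W <= k <= minn B n)%N
  then 'C(B, k)%:R * 'C(W, n - k)%:R / 'C(B + W, n)%:R else 0.

Lemma hypergeometric_pmf_ge0 k : 0 <= hypergeometric_pmf k.
Proof. by rewrite /hypergeometric_pmf; case: ifP => // _; rewrite divr_ge0// mulr_ge0. Qed.

Lemma hypergeometric_pmf_sum : (n <= B + W)%N ->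
  \sum_(k < n.+1) hypergeometric_pmf k = 1.
Proof.
move=> nBW.
have C0 : 'C(B + W, n)%:R != 0 :> R by rewrite pnatr_eq0 -lt0n bin_gt0.
transitivity (\sum_(k < n.+1) ('C(B, k) * 'C(W, n - k))%:R / 'C(B + W, n)%:R : R).
  apply: eq_bigr => k _; rewrite /hypergeometric_pmf; case: ifPn => [_|].
    by rewrite natrM.
  rewrite negb_and -!ltnNge => /orP[kn|].
    by rewrite (@bin_small W) ?muln0 ?mul0r// ltn_subRL addnC -ltn_subRL.
  rewrite gtn_min => /orP[kB|]; first by rewrite bin_small// mul0n mul0r.
  by rewrite ltnNge -ltnS ltn_ord.
by rewrite -mulr_suml -natr_sum binomial.Vandermonde divff.
Qed.

End hypergeometric.

(* As for [binomial_prob] and [poisson_prob], inadmissible parameters yield the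
   Dirac measure at 0. *)
Definition hypergeometric_prob {R : realType} (B W n : nat) : set nat -> \bar R :=
  fun U => if (n <= B + W)%N then
    \esum_(k in U) (hypergeometric_pmf B W n k)%:E else \d_0%N U.

Section hypergeometric_probability.
Context {R : realType} (B W n : nat).
Local Open Scope ereal_scope.

Local Notation hyp := (@hypergeometric_prob R B W n).

Let hyp0 : hyp set0 = 0.
Proof.
by rewrite /hypergeometric_prob measure0; case: ifPn => //; rewrite esum_set0.
Qed.

Let hyp_ge0 U : 0 <= hyp U.
Proof.
rewrite /hypergeometric_prob; case: ifPn => // _; apply: esum_ge0 => /= k Uk.
by rewrite lee_fin hypergeometric_pmf_ge0.
Qed.

Let hyp_sigma_additive : semi_sigma_additive hyp.
Proof.
move=> F mF tF mUF; rewrite /hypergeometric_prob; case: ifPn => _; last first.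
  exact: measure_semi_sigma_additive.
apply: cvg_toP.
  apply: ereal_nondecreasing_is_cvgn => a b ab.
  apply: lee_sum_nneg_natr => // k _ _.
  by apply: esum_ge0 => /= ? _; rewrite lee_fin hypergeometric_pmf_ge0.
by rewrite nneseries_sum_bigcup// => i; rewrite lee_fin hypergeometric_pmf_ge0.
Qed.

HB.instance Definition _ := isMeasure.Build _ _ _ hyp
  hyp0 hyp_ge0 hyp_sigma_additive.

Let hyp_setT : hyp [set: _] = 1.
Proof.
rewrite /hypergeometric_prob; case: ifPn => [nBW|_]; last by rewrite probability_setT.
have h0 k : 0 <= (@hypergeometric_pmf R B W n k)%:E.
  by rewrite lee_fin hypergeometric_pmf_ge0.
rewrite (esumID `I_n.+1)// [X in _ + X]esum1 ?adde0; last first.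
  move=> /= k [_ /negP]; rewrite -leqNgt => nk.
  rewrite /hypergeometric_pmf; case: ifP => // /andP[_].
  by rewrite leq_min => /andP[_]; rewrite leqNgt nk.
rewrite setTI esum_fset// -fsbig_ord//=.
by rewrite sumEFin hypergeometric_pmf_sum.
Qed.

HB.instance Definition _ :=
  @Measure_isProbability.Build _ _ R hyp hyp_setT.

End hypergeometric_probability.

(* The generalized binomial coefficient (r + k - 1 choose k). *)
Definition negbin_coef {R : realType} (r : R) (k : nat) : R :=
  (\prod_(i < k) (r + i%:R)) / k`!%:R.

Definition negbin_pmf {R : realType} (r p : R) (k : nat) : R :=
  negbin_coef r k * p `^ r * (1 - p) ^+ k.

Section negbin_series.
Context {R : realType}.
Implicit Types (r q p x : R) (n k : nat).

Lemma negbin_coef_ge0 r k : 0 < r -> 0 <= negbin_coef r k.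
Proof. by move=> r0; rewrite divr_ge0// prodr_ge0// => i _; rewrite addr_ge0// ltW. Qed.

Lemma negbin_coef0 r : negbin_coef r 0 = 1.
Proof. by rewrite /negbin_coef big_ord0 fact0 divr1. Qed.

Lemma negbin_coefS r k : k.+1%:R * negbin_coef r k.+1 = (r + k%:R) * negbin_coef r k.
Proof.
rewrite /negbin_coef big_ord_recr/= factS natrM.
have k1 : k.+1%:R != 0 :> R by rewrite pnatr_eq0.
have f0 : k`!%:R != 0 :> R by rewrite pnatr_eq0 -lt0n fact_gt0.
by field; rewrite f0 -[1%R]/(1%:R) -natrD.
Qed.

Lemma negbin_coefS_shift r k : k.+1%:R * negbin_coef r k.+1 = r * negbin_coef (r + 1) k.
Proof.
rewrite /negbin_coef big_ord_recl/= factS natrM addr0.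
under eq_bigr do rewrite /bump /= add1n -natr1 addrCA addrC.
rewrite [in RHS](eq_bigr (fun i : 'I_k => i%:R + r + 1)); last first.
  by move=> i _; ring.
rewrite [in LHS](eq_bigr (fun i : 'I_k => i%:R + r + 1)); last first.
  by move=> i _; ring.
have k1 : k.+1%:R != 0 :> R by rewrite pnatr_eq0.
have f0 : k`!%:R != 0 :> R by rewrite pnatr_eq0 -lt0n fact_gt0.
by field; rewrite f0 -[1%R]/(1%:R) -natrD.
Qed.

Let g r n : R -> R :=
  fun x => (\sum_(0 <= k < n) negbin_coef r k * x ^+ k) * (1 - x) `^ r.

Let is_derive_g r n (x : R) : x < 1 -> 0 < r ->
  is_derive x 1 (g r n.+1)
    (- (1 - x) `^ (r - 1) * (n.+1%:R * negbin_coef r n.+1) * x ^+ n).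
Proof.
move=> x1 r0.
have x10 : 0 < 1 - x by rewrite subr_gt0.
have dpow : is_derive x 1 (fun y : R => (1 - y) `^ r) (- (r * (1 - x) `^ (r - 1))).
  have d1 : is_derive (1 - x) 1 (fun y : R => y `^ r) (r * (1 - x) `^ (r - 1)).
    exact: is_derive1_powR.
  have d2 : is_derive x 1 (fun y : R => 1 - y) (-1).
    by apply: is_derive_eq; rewrite add0r mul1r.
  by have := @is_derive1_comp R (fun y : R => y `^ r) (fun y : R => 1 - y) x _ _ d1 d2; rewrite mulrN1.
have hr : (1 - x) `^ r = (1 - x) * (1 - x) `^ (r - 1).
  by rewrite mulr_powRB1// ltW.
elim: n => [|n ih].
  rewrite (_ : g r 1 = fun y => (1 - y) `^ r); last first.
    by apply/funext => y; rewrite /g big_nat1 expr0 mulr1 negbin_coef0 mul1r.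
  apply: is_derive_eq; rewrite negbin_coefS negbin_coef0 addr0 expr0; ring.
rewrite (_ : g r n.+2 = g r n.+1 +
    negbin_coef r n.+1 *: ((fun y : R => y ^+ n.+1) * (fun y => (1 - y) `^ r))); last first.
  by apply/funext => y; rewrite /g big_nat_recr//= mulrDl -mulrA.
have dx : is_derive x 1 (fun y : R => y ^+ n.+1) (n.+1%:R * x ^+ n).
  have := is_deriveX n.+1 (@is_derive_id R R x 1).
  rewrite exprfctE /GRing.scale/= mulr1; exact.
have dd := is_deriveD ih (is_deriveZ (negbin_coef r n.+1) (is_deriveM dx dpow)).
apply: is_derive_eq dd _.
rewrite (negbin_coefS r n.+1) /GRing.scale/= hr exprS; ring.
Qed.

Let g_0 r n : g r n.+1 0 = 1.
Proof.
rewrite /g big_nat_recl// big1_seq => [|k _]; last by rewrite exprS mul0r mulr0.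
by rewrite expr0 negbin_coef0 subr0 powR1 !mulr1 addr0.
Qed.

Let g_mvt r n q : 0 < r -> 0 <= q < 1 -> exists2 x : R, 0 <= x <= q &
  g r n.+1 q = 1 - (1 - x) `^ (r - 1) * (r * negbin_coef (r + 1) n) * x ^+ n * q.
Proof.
move=> r0 /andP[q0 q1].
pose df x := - (1 - x) `^ (r - 1) * (n.+1%:R * negbin_coef r n.+1) * x ^+ n.
have [x||x] := @MVT_segment R (g r n.+1) df 0 q q0.
- by rewrite in_itv/= => /andP[_ xq]; apply: is_derive_g => //; exact: lt_trans q1.
- apply: derivable_within_continuous => x; rewrite in_itv/= => /andP[_ xq].
  by have [] := @is_derive_g r n x (le_lt_trans xq q1) r0.
rewrite in_itv/= => xq; rewrite g_0 subr0 => /eqP; rewrite subr_eq => /eqP gq.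
exists x => //; rewrite gq /df negbin_coefS_shift; ring.
Qed.

Let g_le1 r n q : 0 < r -> 0 <= q < 1 -> g r n q <= 1.
Proof.
move=> r0 q01; case: n => [|n]; first by rewrite /g big_nil mul0r.
have [x /andP[x0 xq] ->] := g_mvt n r0 q01.
have /andP[q0 _] := q01.
rewrite gerBl mulr_ge0// mulr_ge0 ?exprn_ge0// mulr_ge0 ?powR_ge0//.
by rewrite mulr_ge0 ?negbin_coef_ge0 ?addr_gt0// ltW.
Qed.

Let negbin_term_cvg0 r q : 0 < r -> 0 <= q < 1 ->
  (fun n => negbin_coef r n * q ^+ n) @ \oo --> 0.
Proof.
move=> r0 q01; have /andP[q0 q1] := q01.
have q10 : 0 < (1 - q) `^ r by rewrite powR_gt0// subr_gt0.
apply: cvg_series_cvg_0; apply: nondecreasing_is_cvgn.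
  apply: nondecreasing_series => n _ _.
  by rewrite mulr_ge0 ?exprn_ge0 ?negbin_coef_ge0.
exists ((1 - q) `^ r)^-1 => _ [n _ <-].
by rewrite -[leRHS]mul1r ler_pdivlMr// g_le1.
Qed.

Lemma negbin_pmf_ge0 r p k : 0 < r -> 0 < p <= 1 -> 0 <= negbin_pmf r p k.
Proof.
move=> r0 /andP[p0 p1].
apply: mulr_ge0; last by rewrite exprn_ge0 ?subr_ge0.
by apply: mulr_ge0; [exact: negbin_coef_ge0|exact: powR_ge0].
Qed.

Lemma cvg_series_negbin_pmf r p : 0 < r -> 0 < p <= 1 ->
  series (negbin_pmf r p) @ \oo --> (1 : R).
Proof.
move=> r0 /andP[p0 p1]; pose q := 1 - p.
have q01 : 0 <= q < 1 by rewrite subr_ge0 p1 gtrBl.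
have /andP[q0 q1] := q01.
rewrite (_ : series _ = g r ^~ q); last first.
  apply/funext => n; rewrite /g /series/= big_distrl/=; apply: eq_bigr => k _.
  by rewrite /negbin_pmf subKr mulrAC.
rewrite -cvg_shiftS.
pose b n := 1 - p^-1 * r * (negbin_coef (r + 1) n * q ^+ n).
apply: (@squeeze_cvgr _ _ _ _ b (cst 1)).
- apply: nearW => n; rewrite /= g_le1// andbT.
  have [x /andP[x0 xq] ->] := g_mvt n r0 q01.
  rewrite /b lerD2l lerN2.
  have x1 : 0 < 1 - x by rewrite subr_gt0 (le_lt_trans xq).
  have c0 : 0 <= negbin_coef (r + 1) n by rewrite negbin_coef_ge0// addr_gt0.
  have xnq : x ^+ n <= q ^+ n by rewrite lerXn2r ?nnegrE.
  have xr : (1 - x) `^ (r - 1) <= p^-1.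
    rewrite powRB ?(gt_eqF x1) ?implybT// powRr1 ?(ltW x1)// -[leRHS]mul1r.
    apply: ler_pM; rewrite ?powR_ge0 ?invr_ge0 ?(ltW x1)//.
      have x1' : 1 - x <= 1 by rewrite gerBl.
      have := @ge0_ler_powR _ _ (ltW r0) (1 - x) 1.
      by rewrite powR1; apply; rewrite ?nnegrE ?(ltW x1).
    by rewrite lef_pV2 ?posrE// lerBrDr addrC -lerBrDr.
  move: (negbin_coef _ _) c0 => c c0.
  rewrite -!mulrA; apply: ler_pM => //; first exact: powR_ge0.
    by rewrite !mulr_ge0 ?exprn_ge0// ltW.
  rewrite ler_wpM2l ?(ltW r0)// ler_wpM2l// -[leRHS]mulr1.
  by rewrite ler_pM ?exprn_ge0// ltW.
- rewrite -[X in _ --> X]subr0; apply: cvgB; first exact: cvg_cst.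
  rewrite -(mulr0 (p^-1 * r)); apply: cvgMl_tmp.
  by apply: negbin_term_cvg0 => //; rewrite addr_gt0.
- exact: cvg_cst.
Qed.

End negbin_series.

Definition negbin_prob {R : realType} (r p : R) : set nat -> \bar R :=
  fun U => if (0 < r) && (0 < p <= 1) then
    \esum_(k in U) (negbin_pmf r p k)%:E else \d_0%N U.

Section negative_binomial.
Context {R : realType} (r p : R).
Local Open Scope ereal_scope.

Local Notation negbin := (negbin_prob r p).

Let negbin0 : negbin set0 = 0.
Proof. by rewrite /negbin_prob measure0; case: ifPn => //; rewrite esum_set0. Qed.

Let negbin_ge0 U : 0 <= negbin U.
Proof.
rewrite /negbin_prob; case: ifPn => // /andP[r0 p01]; apply: esum_ge0 => /= k Uk.
by rewrite lee_fin negbin_pmf_ge0.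
Qed.

Let negbin_sigma_additive : semi_sigma_additive negbin.
Proof.
move=> F mF tF mUF; rewrite /negbin_prob; case: ifPn => [/andP[r0 p01]|_]; last first.
  exact: measure_semi_sigma_additive.
apply: cvg_toP.
  apply: ereal_nondecreasing_is_cvgn => a b ab.
  apply: lee_sum_nneg_natr => // k _ _.
  by apply: esum_ge0 => /= ? _; rewrite lee_fin negbin_pmf_ge0.
by rewrite nneseries_sum_bigcup// => i; rewrite lee_fin negbin_pmf_ge0.
Qed.

HB.instance Definition _ := isMeasure.Build _ _ _ negbin
  negbin0 negbin_ge0 negbin_sigma_additive.

Let negbin_setT : negbin [set: _] = 1.
Proof.
rewrite /negbin_prob; case: ifPn => [/andP[r0 p01]|_]; last by rewrite probability_setT.
rewrite -nneseries_esumT; last by move=> k; rewrite lee_fin negbin_pmf_ge0.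
have h := cvg_series_negbin_pmf r0 p01.
rewrite -(cvg_lim _ h)// -EFin_lim; last by apply/cvg_ex; exists 1%R.
by apply/congr_lim/funext => n; rewrite /= /series/= sumEFin.
Qed.

HB.instance Definition _ :=
  @Measure_isProbability.Build _ _ R negbin negbin_setT.

End negative_binomial.

(* Main.v *)
(* With f1, f2 the mass functions, P1 <=_st P2 holds as soon as f1 - f2 changes
   sign at most once, from + to -. If this fails there are i < j with
   f1 i < f2 i and f1 j > f2 j, so the ratio f2/f1 decreases between i and j,
   while the left tail condition makes it increase before i and the right tail
   condition makes it increase after j. But f2(k+1) f1(k) - f1(k+1) f2(k) has,
   up to a positive factor, the sign of a linear or concave quadratic
   polynomial in k, and these never exhibit the sign pattern + - +. *)
Require Import Defs.
From HB Require Import structures.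
From mathcomp Require Import all_boot all_order all_algebra.
From mathcomp Require Import all_classical all_reals all_analysis.
From mathcomp Require Import zify ring lra.
Set Implicit Arguments.
Unset Strict Implicit.
Unset Printing Implicit Defensive.
Import Order.TTheory GRing.Theory Num.Theory.
Import numFieldNormedType.Exports.
Local Open Scope classical_set_scope.
Local Open Scope ring_scope.

(** * Stochastic order for laws on the natural numbers, in terms of heads, tails and point masses *)

Section law_on_nat.
Context {R : realType}.
Implicit Types (P Q : probability nat R) (A : set nat) (f g : nat -> R).

(** Masses may vanish, so statements about the ratio are made with cross products instead of
    quotients. All the laws satisfy a recurrence [f k.+1 * (k.+1%:R * u k) = f k * v k] with
    polynomials [u] and [v] in [k], and where [u] and [u'] are positive the cross difference is a
    nonnegative multiple of [v' k * u k - v k * u' k]. For two hypergeometric laws the cubic terms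
    of this polynomial cancel and its quadratic coefficient is [B1 + W1 - (B2 + W2)]: hence the
    condition on the population sizes. The alternative condition provides a common linear factor,
    which leaves a linear cofactor. A linear or concave quadratic function that is negative at a
    point is nonpositive on one whole side of it. So each violation is refuted by one endpoint
    inequality, and which one may depend on the point where the ratio decreases. *)

Lemma le_measure_pointwise P Q A :
  (forall k, A k -> P [set k] <= Q [set k])%E -> (P A <= Q A)%E.
Proof.
move=> PQ; have -> : A = \bigcup_(k in A) [set k].
  by apply/seteqP; split=> [k Ak|_ [k Ak ->]//]; exists k.
have disjA : trivIset A (fun k : nat => [set k]).
  by move=> i j _ _ [k [-> ->]].
rewrite !measure_bigcup//.
apply: lee_nneseries => [k _ _|k kA]; first exact: measure_ge0.
exact: PQ (set_mem kA).
Qed.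

Lemma st_le_tails P Q : st_le (real_law P) (real_law Q) <->
  (forall m, P [set k | (m <= k)%N] <= Q [set k | (m <= k)%N])%E.
Proof.
have tailE P' x : real_law P' `[x, +oo[%classic = P' [set k | x <= k%:R].
  congr (P' _); apply/seteqP; split=> k /=; rewrite in_itv/= andbT //.
split=> [PQ m|PQ x].
  have := PQ m%:R; rewrite !tailE.
  suff -> : [set k | m%:R <= k%:R :> R] = [set k | (m <= k)%N] by [].
  by apply/seteqP; split=> k /=; rewrite ler_nat.
rewrite !tailE.
(* The tail from a real [x] is the tail from the least natural number not below [x]. *)
have exm : exists m, x <= m%:R.
  by exists (Num.truncn x).+1; rewrite ltW// truncnS_gt.
case: (ex_minnP exm) => m xm mmin.
suff -> : [set k | x <= k%:R] = [set k | (m <= k)%N] by [].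
apply/seteqP; split=> k /=; first exact: mmin.
by rewrite -(ler_nat R); exact: le_trans.
Qed.

Lemma tail_lt m : [set k | (m <= k)%N] = ~` [set k | (k < m)%N].
Proof.
by apply/seteqP; split=> k /= => [mk|/negP]; [apply/negP|]; rewrite -leqNgt.
Qed.

Lemma probability_tail P m :
  P [set k | (m <= k)%N] = (1 - P [set k | (k < m)%N])%E.
Proof. by rewrite tail_lt probability_setC. Qed.

Lemma st_le_heads P Q : st_le (real_law P) (real_law Q) <->
  (forall m, Q [set k | (k < m)%N] <= P [set k | (k < m)%N])%E.
Proof.
rewrite st_le_tails; split=> PQ m; have := PQ m; rewrite !probability_tail.
  by rewrite leeD2lE// leeN2.
by rewrite leeD2lE// leeN2.
Qed.

(* At a level [m], either every difference [P k - Q k] below [m] is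
   nonnegative, or every difference above [m] is nonpositive. *)
Lemma st_le_crossing P Q f g :
  (forall k, P [set k] = (f k)%:E) -> (forall k, Q [set k] = (g k)%:E) ->
  (forall i j, (i < j)%N -> f i < g i -> f j <= g j) ->
  st_le (real_law P) (real_law Q).
Proof.
move=> Pf Qg fg; apply/st_le_tails => m.
have [[i [im fgi]]|gf] := pselect (exists i, (i < m)%N /\ f i < g i).
  apply: le_measure_pointwise => k /= mk; rewrite Pf Qg lee_fin.
  by apply: (fg i) => //; exact: leq_trans mk.
rewrite !probability_tail leeD2lE// leeN2.
apply: le_measure_pointwise => k /= km; rewrite Pf Qg lee_fin leNgt.
by apply/negP => fgk; apply: gf; exists k.
Qed.

(** Yields the necessity of the left tail conditions: in the head inequality at [m.+1], the finite
    head masses below [m] are ordered the other way and cancel. At the least point of the joint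
    support the premise holds because all masses below vanish. *)
Lemma st_le_head P Q f g m :
  (forall k, P [set k] = (f k)%:E) -> (forall k, Q [set k] = (g k)%:E) ->
  st_le (real_law P) (real_law Q) ->
  (forall k, (k < m)%N -> f k <= g k) -> g m <= f m.
Proof.
move=> Pf Qg /st_le_heads/(_ m.+1) + fg.
have -> : [set k | (k < m.+1)%N] = [set k | (k < m)%N] `|` [set m].
  by apply/seteqP; split=> k /=; lia.
rewrite !measureU//; [|by apply/seteqP; split=> k //=; lia..].
have PQ : (P [set k | (k < m)%N] <= Q [set k | (k < m)%N])%E.
  by apply: le_measure_pointwise => k /= km; rewrite Pf Qg lee_fin fg.
rewrite [X in (_ + X <= _)%E](Qg m) [X in (_ <= _ + X)%E](Pf m) => QP.
have := le_trans (leeD2r (g m)%:E PQ) QP.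
by rewrite leeD2lE ?lee_fin// fin_num_measure.
Qed.

(** Mirror image of [st_le_head]. For unbounded supports the premise comes from eventual domination
    of one mass function by the other. *)
Lemma st_le_tail P Q f g m :
  (forall k, P [set k] = (f k)%:E) -> (forall k, Q [set k] = (g k)%:E) ->
  st_le (real_law P) (real_law Q) ->
  (forall k, (m < k)%N -> g k <= f k) -> f m <= g m.
Proof.
move=> Pf Qg /st_le_tails/(_ m) + fg.
have -> : [set k | (m <= k)%N] = [set k | (m < k)%N] `|` [set m].
  by apply/seteqP; split=> k /=; lia.
rewrite !measureU//; [|by apply/seteqP; split=> k //=; lia..].
have QP : (Q [set k | (m < k)%N] <= P [set k | (m < k)%N])%E.
  by apply: le_measure_pointwise => k /= km; rewrite Pf Qg lee_fin fg.
rewrite [X in (_ + X <= _)%E](Pf m) [X in (_ <= _ + X)%E](Qg m) => PQ.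
have := le_trans (leeD2r (f m)%:E QP) PQ.
by rewrite leeD2lE ?lee_fin// fin_num_measure.
Qed.

Lemma limn_esup_le1 (u : (\bar R)^nat) K :
  (forall k, (K <= k)%N -> (u k <= 1)%E) -> (limn_esup u <= 1)%E.
Proof.
move=> u1; rewrite /limn_esup limf_esupE.
apply: (@le_trans _ _ (ereal_sup (u @` [set k | (K <= k)%N]))).
  by apply: ereal_inf_lbound; exists [set k | (K <= k)%N] => //; exists K.
by apply: ge_ereal_sup => _ [k /= Kk <-]; exact: u1.
Qed.

End law_on_nat.

(** * Monotonicity of the ratio of two mass functions and sign changes *)

Section ratio_crossing.
Context {R : realFieldType}.
Implicit Types (f g D : nat -> R).

(** By induction on [b], look at the last step. If [f] is still below [g] at [b], shorten the
    interval. Otherwise positivity of [f + g] makes [f b] and [g b.+1] positive, so the last step is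
    itself a strict increase, unless [f] and [g] agree at both of its ends; then the strictness must
    come from [a] and the interval is shortened again. *)
Lemma ratio_increase f g a b : (a <= b)%N ->
  (forall k, 0 <= f k) -> (forall k, 0 <= g k) ->
  (forall k, (a <= k <= b)%N -> 0 < f k + g k) ->
  g a <= f a -> f b <= g b -> (g a < f a) || (f b < g b) ->
  exists2 x, (a <= x < b)%N & f x.+1 * g x < g x.+1 * f x.
Proof.
move=> ab f0 g0; elim: b ab => [|b IH].
  rewrite leqn0 => /eqP -> _ gf fg; rewrite !ltNge.
  by rewrite gf fg.
rewrite leq_eqVlt => /predU1P[<- _ gf fg|]; first by rewrite !ltNge gf fg.
rewrite ltnS => ab pos gfa fgb strict.
have posb k : (a <= k <= b)%N -> 0 < f k + g k.
  by case/andP=> ak kb; apply: pos; rewrite ak ltnW.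
have extend : f b <= g b -> (g a < f a) || (f b < g b) ->
    exists2 x, (a <= x < b.+1)%N & f x.+1 * g x < g x.+1 * f x.
  move=> fgb' strict'.
  have [x /andP[ax xb] xE] := IH ab posb gfa fgb' strict'.
  by exists x => //; rewrite ax ltnW.
have [fgb'|gfb] := ltP (f b) (g b).
  by apply: extend; [exact: ltW|rewrite fgb' orbT].
have fb : 0 < f b.
  rewrite lt_neqAle f0 andbT eq_sym; apply/negP => /eqP fb0.
  have : 0 < f b + g b by apply: posb; rewrite ab leqnn.
  by rewrite fb0 add0r ltNge -fb0 gfb.
have gb1 : 0 < g b.+1.
  have : 0 < f b.+1 + g b.+1 by apply: pos; rewrite leqnn leqW.
  by have := f0 b.+1; lra.
have [lt1|ge1] := ltP (f b.+1) (g b.+1).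
  exists b; first by rewrite ab ltnSn.
  apply: (@le_lt_trans _ _ (f b.+1 * f b)); first by rewrite ler_wpM2l.
  by rewrite ltr_pM2r.
have fgE : f b.+1 = g b.+1 by apply/eqP; rewrite eq_le fgb ge1.
move: gfb; rewrite le_eqVlt => /predU1P[gfE|gfb].
  by apply: extend; rewrite -?gfE//; move: strict; rewrite fgE ltxx orbF => ->.
exists b; first by rewrite ab ltnSn.
by rewrite fgE ltr_pM2l.
Qed.

(* A violation makes the ratio [g / f] decrease at some [y] between [i] and
   [j], while the condition at [a] (resp. [b]) makes it increase somewhere
   before [i] (resp. after [j]); [D] carries the sign of these increments. *)
Lemma ratio_crossing f g D a b i j :
  (forall k, 0 <= f k) -> (forall k, 0 <= g k) ->
  (forall k, (a <= k <= b)%N -> 0 < f k + g k) ->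
  (forall k, (a <= k < b)%N -> f k.+1 * g k < g k.+1 * f k -> 0 < D k) ->
  (forall k, (a <= k < b)%N -> g k.+1 * f k < f k.+1 * g k -> D k < 0) ->
  (forall y, (a <= y < b)%N -> D y < 0 ->
    (g a <= f a /\ forall x, (a <= x < y)%N -> D x <= 0) \/
    (f b <= g b /\ forall z, (y < z < b)%N -> D z <= 0)) ->
  (a <= i)%N -> (i < j)%N -> (j <= b)%N -> f i < g i -> f j <= g j.
Proof.
move=> f0 g0 pos Dup Ddown H ai ij jb fgi; rewrite leNgt; apply/negP => gfj.
have [y /andP[iy yj] Ey] : exists2 y, (i <= y < j)%N &
    g y.+1 * f y < f y.+1 * g y.
  apply: ratio_increase => //; rewrite ?(ltW fgi) ?(ltW gfj) ?fgi ?(ltnW ij)//.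
  by move=> k ikj; rewrite addrC; apply: pos; lia.
have Dy : D y < 0 by apply: Ddown => //; lia.
have ayb : (a <= y < b)%N by lia.
have [[gfa Dle]|[fgb Dle]] := H y ayb Dy.
- have [x /andP[ax xi] Ex] : exists2 x, (a <= x < i)%N &
      f x.+1 * g x < g x.+1 * f x.
    apply: ratio_increase => //; rewrite ?(ltW fgi) ?fgi ?orbT//.
    by move=> k aki; apply: pos; lia.
  have : 0 < D x by apply: Dup => //; lia.
  by rewrite ltNge Dle//; lia.
- have [z /andP[jz zb] Ez] : exists2 z, (j <= z < b)%N &
      f z.+1 * g z < g z.+1 * f z.
    apply: ratio_increase => //; rewrite ?(ltW gfj) ?gfj//.
    by move=> k jkb; apply: pos; lia.
  have : 0 < D z by apply: Dup => //; lia.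
  by rewrite ltNge Dle//; lia.
Qed.

(** Multiplying the cross difference by [c * u * u'] turns it into [f0 * g0 * (v' * u - v * u')].
    The converse implications may fail, since [f0 * g0] can be zero. *)
Lemma ratio_sign (c f0 f1 u v g0 g1 u' v' : R) :
  0 <= f0 -> 0 <= g0 -> 0 < c -> 0 < u -> 0 < u' ->
  f1 * (c * u) = f0 * v -> g1 * (c * u') = g0 * v' ->
  (f1 * g0 < g1 * f0 -> 0 < v' * u - v * u') /\
  (g1 * f0 < f1 * g0 -> v' * u - v * u' < 0).
Proof.
move=> f0_ge0 g0_ge0 c0 u0 u'0 fE gE.
have E : (g1 * f0 - f1 * g0) * (c * u * u') = f0 * g0 * (v' * u - v * u').
  transitivity ((g1 * (c * u')) * f0 * u - (f1 * (c * u)) * g0 * u').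
    by ring.
  by rewrite fE gE; ring.
have cuu' : 0 < c * u * u' by rewrite !mulr_gt0.
have fg : 0 <= f0 * g0 by rewrite mulr_ge0.
split=> lt; rewrite ltNge; apply/negP => D.
- have : 0 < (g1 * f0 - f1 * g0) * (c * u * u') by rewrite mulr_gt0// subr_gt0.
  by rewrite E ltNge mulr_ge0_le0.
- have : (g1 * f0 - f1 * g0) * (c * u * u') < 0.
    by rewrite pmulr_llt0// subr_lt0.
  by rewrite E ltNge mulr_ge0.
Qed.

Lemma recurrence_crossing f g (u v u' v' : nat -> R) a b i j :
  (forall k, 0 <= f k) -> (forall k, 0 <= g k) ->
  (forall k, (a <= k <= b)%N -> 0 < f k + g k) ->
  (forall k, f k.+1 * (k.+1%:R * u k) = f k * v k) ->
  (forall k, g k.+1 * (k.+1%:R * u' k) = g k * v' k) ->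
  (forall k, (a <= k < b)%N -> 0 < u k) ->
  (forall k, (a <= k < b)%N -> 0 < u' k) ->
  let D k := v' k * u k - v k * u' k in
  (forall y, (a <= y < b)%N -> D y < 0 ->
    (g a <= f a /\ forall x, (a <= x < y)%N -> D x <= 0) \/
    (f b <= g b /\ forall z, (y < z < b)%N -> D z <= 0)) ->
  (a <= i)%N -> (i < j)%N -> (j <= b)%N -> f i < g i -> f j <= g j.
Proof.
move=> f0 g0 pos fS gS u0 u'0 D.
apply: ratio_crossing => // k akb; have k1 : 0 < k.+1%:R :> R by rewrite ltr0n.
  have [+ _] := ratio_sign (f0 k) (g0 k) k1 (u0 k akb) (u'0 k akb) (fS k) (gS k).
  exact.
have [_ +] := ratio_sign (f0 k) (g0 k) k1 (u0 k akb) (u'0 k akb) (fS k) (gS k).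
exact.
Qed.

(** In the expansion at [y] the second-order term is nonpositive, so the function lies below its
    tangent, whose slope selects the side. Linear functions are the case [c2 = 0]. *)
Lemma concave_quadratic_one_side (c2 c1 c0 y : R) : c2 <= 0 ->
  c2 * y ^+ 2 + c1 * y + c0 < 0 ->
  (forall x, x < y -> c2 * x ^+ 2 + c1 * x + c0 <= 0) \/
  (forall z, y < z -> c2 * z ^+ 2 + c1 * z + c0 <= 0).
Proof.
move=> c2_le0 Dy.
have taylor x : c2 * x ^+ 2 + c1 * x + c0 = c2 * y ^+ 2 + c1 * y + c0 +
    (c2 * y *+ 2 + c1) * (x - y) + c2 * (x - y) ^+ 2 by ring.
have c2sq x : c2 * (x - y) ^+ 2 <= 0 by rewrite mulr_le0_ge0// sqr_ge0.
have [s_ge0|s_lt0] := leP 0 (c2 * y *+ 2 + c1); [left|right] => x xy.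
  rewrite taylor; have := c2sq x.
  have : (c2 * y *+ 2 + c1) * (x - y) <= 0.
    by rewrite mulr_ge0_le0// subr_le0 ltW.
  by lra.
rewrite taylor; have := c2sq x.
have : (c2 * y *+ 2 + c1) * (x - y) <= 0.
  by rewrite mulr_le0_ge0 ?subr_ge0// ltW.
by lra.
Qed.

End ratio_crossing.

(** The difference is taken in the ring, not truncated; for [k > n] both coefficients vanish. This
    lets the mass recurrences hold for every [k]. *)
Lemma natmul_bin_succ (R : comPzRingType) (n k : nat) :
  'C(n, k.+1)%:R * k.+1%:R = 'C(n, k)%:R * (n%:R - k%:R) :> R.
Proof.
have [kn|nk] := leqP k n.
  by rewrite -natrB// -!natrM mulnC mul_bin_left mulnC.
by rewrite !bin_small ?mul0r// ltnW.
Qed.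

(** * Point masses of the four families and their recurrences *)

Section pmfs.
Context {R : realType}.

Lemma binomial_prob_set1 n (p : R) k : 0 <= p <= 1 ->
  (binomial_prob n p [set k] = (binomial_pmf n p k)%:E)%E.
Proof.
by move=> p01; rewrite /binomial_prob p01 esum_set1// lee_fin binomial_pmf_ge0.
Qed.

Lemma binomial_pmfE n (p : R) k :
  binomial_pmf n p k = 'C(n, k)%:R * (p ^+ k * (1 - p) ^+ (n - k)).
Proof. by rewrite /binomial_pmf -mulr_natl. Qed.

Lemma binomial_pmf_gt0 n (p : R) k : 0 < p < 1 -> (k <= n)%N ->
  0 < binomial_pmf n p k.
Proof.
move=> /andP[p0 p1] kn; rewrite binomial_pmfE mulr_gt0//.
  by rewrite ltr0n bin_gt0.
by rewrite mulr_gt0// exprn_gt0// subr_gt0.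
Qed.

Lemma binomial_pmf_eq0 n (p : R) k : (n < k)%N -> binomial_pmf n p k = 0.
Proof. by move=> nk; rewrite /binomial_pmf bin_small. Qed.

Lemma binomial_pmf0 n (p : R) : binomial_pmf n p 0 = (1 - p) ^+ n.
Proof. by rewrite /binomial_pmf bin0 expr0 mul1r subn0 mulr1n. Qed.

Lemma binomial_pmf_last n (p : R) : binomial_pmf n p n = p ^+ n.
Proof. by rewrite /binomial_pmf binn subnn expr0 mulr1. Qed.

Lemma binomial_pmfS n (p : R) k :
  binomial_pmf n p k.+1 * (k.+1%:R * (1 - p)) =
  binomial_pmf n p k * ((n%:R - k%:R) * p).
Proof.
have [kn|nk] := ltnP k n; last first.
  rewrite binomial_pmf_eq0// mul0r; move: nk; rewrite leq_eqVlt => /predU1P[->|nk].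
    by rewrite subrr mul0r mulr0.
  by rewrite binomial_pmf_eq0// mul0r.
rewrite !binomial_pmfE -(subnSK kn) !exprS.
have := natmul_bin_succ R n k.
move: 'C(n, k.+1)%:R 'C(n, k)%:R (p ^+ k) ((1 - p) ^+ _) => c d P S cd.
transitivity (p * P * S * (c * k.+1%:R) * (1 - p)); first by ring.
by rewrite cd; ring.
Qed.

Lemma hypergeometric_prob_set1 B W n k : (n <= B + W)%N ->
  (hypergeometric_prob B W n [set k] = (@hypergeometric_pmf R B W n k)%:E)%E.
Proof.
move=> nBW; rewrite /hypergeometric_prob nBW esum_set1//.
by rewrite lee_fin hypergeometric_pmf_ge0.
Qed.

(** Most of the support condition is automatic, because a binomial coefficient vanishes. The guard
    [k <= n] must stay: for [k > n] the truncated [n - k] is 0 and ['C(W, 0)] is 1. *)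
Lemma hypergeometric_pmfE B W n k : hypergeometric_pmf B W n k =
  (if (k <= n)%N then 'C(B, k)%:R * 'C(W, n - k)%:R / 'C(B + W, n)%:R else 0 : R).
Proof.
rewrite /hypergeometric_pmf; case: ifP => [/andP[_]|].
  by rewrite leq_min => /andP[_ ->].
move/negbT; rewrite negb_and -!ltnNge => H; case: ifP => // kn.
case/orP: H => [kW|]; first by rewrite (@bin_small W) ?mulr0 ?mul0r//; lia.
by move=> kB; rewrite (@bin_small B) ?mul0r//; lia.
Qed.

Lemma hypergeometric_pmf_gt0 B W n k : (n <= B + W)%N ->
  (0 < @hypergeometric_pmf R B W n k) = (n - W <= k <= minn B n)%N.
Proof.
move=> nBW; rewrite /hypergeometric_pmf; case: ifP => [kP|]; last by rewrite ltxx.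
by rewrite divr_gt0 ?mulr_gt0// ltr0n bin_gt0; lia.
Qed.

Lemma hypergeometric_pmf_eq0 B W n k : ~~ (n - W <= k <= minn B n)%N ->
  hypergeometric_pmf B W n k = 0 :> R.
Proof. by rewrite /hypergeometric_pmf => /negbTE ->. Qed.

Lemma hypergeometric_pmf0 B W n :
  hypergeometric_pmf B W n 0 = 'C(W, n)%:R / 'C(B + W, n)%:R :> R.
Proof. by rewrite hypergeometric_pmfE bin0 mul1r subn0. Qed.

Lemma hypergeometric_pmf_last B W n :
  hypergeometric_pmf B W n n = 'C(B, n)%:R / 'C(B + W, n)%:R :> R.
Proof. by rewrite hypergeometric_pmfE leqnn subnn bin0 mulr1. Qed.

Lemma hypergeometric_pmfS B W n k :
  hypergeometric_pmf B W n k.+1 * (k.+1%:R * (W%:R + k.+1%:R - n%:R)) =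
  hypergeometric_pmf B W n k * ((B%:R - k%:R) * (n%:R - k%:R)) :> R.
Proof.
rewrite !hypergeometric_pmfE; have [kn|nk] := ltnP k n; last first.
  rewrite mul0r; move: nk; rewrite leq_eqVlt => /predU1P[->|nk].
    by rewrite subrr !mulr0.
  by rewrite leqNgt nk mul0r.
rewrite (ltnW kn) -(subnSK kn).
have cB := natmul_bin_succ R B k; have cW := natmul_bin_succ R W (n - k.+1).
move: cW; rewrite (_ : W%:R - (n - k.+1)%:R = W%:R + k.+1%:R - n%:R); last first.
  by rewrite natrB//; ring.
rewrite subnSK// natrB 1?ltnW//.
move: 'C(B, k)%:R 'C(B, k.+1)%:R 'C(W, n - k)%:R 'C(W, n - k.+1)%:R cB.
move: (_^-1) => i b b' w w' cB cW.
transitivity ((b' * k.+1%:R) * (w' * (W%:R + k.+1%:R - n%:R)) * i); first by ring.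
by rewrite cB -cW; ring.
Qed.

Lemma poisson_prob_set1 (l : R) m k : 0 < l ->
  (poisson_prob l m [set k] = (poisson_pmf l k)%:E)%E.
Proof.
by move=> l0; rewrite /poisson_prob l0 esum_set1// lee_fin poisson_pmf_ge0.
Qed.

Lemma poisson_pmf_gt0 (l : R) k : 0 < l -> 0 < poisson_pmf l k.
Proof.
move=> l0.
by rewrite /poisson_pmf l0 mulr_gt0 ?expR_gt0// mulr_gt0 ?exprn_gt0//.
Qed.

Lemma poisson_pmf0 (l : R) : 0 < l -> poisson_pmf l 0 = expR (- l).
Proof. by move=> l0; rewrite /poisson_pmf l0 expr0 fact0 invr1 !mul1r. Qed.

Lemma poisson_pmfS (l : R) k : 0 < l ->
  poisson_pmf l k.+1 * k.+1%:R = poisson_pmf l k * l.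
Proof.
move=> l0; rewrite /poisson_pmf l0 factS natrM invfM exprS.
have k1 : k.+1%:R != 0 :> R by rewrite pnatr_eq0.
transitivity (l ^+ k * k`!%:R^-1 * expR (- l) * l * (k.+1%:R^-1 * k.+1%:R)).
  by ring.
by rewrite mulVf// mulr1.
Qed.

Lemma negbin_prob_set1 (r p : R) k : 0 < r -> 0 < p <= 1 ->
  (negbin_prob r p [set k] = (negbin_pmf r p k)%:E)%E.
Proof.
by move=> r0 p01; rewrite /negbin_prob r0 p01 esum_set1// lee_fin negbin_pmf_ge0.
Qed.

Lemma negbin_pmf_gt0 (r p : R) k : 0 < r -> 0 < p < 1 -> 0 < negbin_pmf r p k.
Proof.
move=> r0 /andP[p0 p1]; apply: mulr_gt0; last by rewrite exprn_gt0// subr_gt0.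
apply: mulr_gt0; last by rewrite powR_gt0.
rewrite /negbin_coef divr_gt0 ?ltr0n ?fact_gt0// prodr_gt0// => i _.
by rewrite ltr_wpDr.
Qed.

Lemma negbin_pmf0 (r p : R) : negbin_pmf r p 0 = p `^ r.
Proof. by rewrite /negbin_pmf negbin_coef0 mul1r expr0 mulr1. Qed.

Lemma negbin_pmfS (r p : R) k :
  negbin_pmf r p k.+1 * k.+1%:R = negbin_pmf r p k * ((r + k%:R) * (1 - p)).
Proof.
rewrite /negbin_pmf exprS.
transitivity (k.+1%:R * negbin_coef r k.+1 * p `^ r * (1 - p) * (1 - p) ^+ k).
  by ring.
by rewrite negbin_coefS; ring.
Qed.

End pmfs.

(** * Eventual domination from a bound on the growth ratios *)

Section domination.
Context {R : realType}.

(** From [K] on, each step multiplies [f / g] by at most [t < 1], so this ratio decays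
    geometrically. *)
Lemma eventually_lt_of_ratio (f g v w : nat -> R) (t : R) K :
  (forall k, 0 <= f k) -> (forall k, 0 < g k) ->
  (forall k, f k.+1 * k.+1%:R = f k * v k) ->
  (forall k, g k.+1 * k.+1%:R = g k * w k) ->
  0 <= t < 1 -> (forall k, (K <= k)%N -> v k <= t * w k) ->
  exists K', forall k, (K' <= k)%N -> f k < g k.
Proof.
move=> f0 g0 fS gS /andP[t0 t1] vw.
have geom n : f (K + n)%N * g K <= t ^+ n * f K * g (K + n)%N.
  elim: n => [|n IH]; first by rewrite addn0 expr0 mul1r.
  have k0 : 0 < (K + n).+1%:R :> R by rewrite ltr0n.
  rewrite addnS -(ler_pM2r k0) [leLHS]mulrAC fS -[leRHS]mulrA gS.
  apply: (@le_trans _ _ (f (K + n)%N * (t * w (K + n)%N) * g K)).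
    by rewrite ler_wpM2r ?(ltW (g0 K))// ler_wpM2l// vw// leq_addr.
  have tw : 0 <= t * w (K + n)%N.
    rewrite mulr_ge0// -(pmulr_rge0 _ (g0 (K + n)%N)) -gS.
    by rewrite mulr_ge0// ltW.
  rewrite exprS; have := ler_wpM2r tw IH.
  by congr (_ <= _); ring.
have t_cvg : (fun n => t ^+ n) @ \oo --> (0 : R).
  by apply: cvg_expr; rewrite ger0_norm.
(* The summand 1 keeps the denominator positive when [f K = 0]. *)
have d0 : 0 < g K / (f K + 1) by rewrite divr_gt0// ltr_wpDl.
have [N _ tN] : \forall n \near \oo, t ^+ n < g K / (f K + 1).
  exact: (cvgr_lt _ t_cvg).
exists (K + N)%N => k KNk.
have Nk : (N <= k - K)%N by lia.
have := geom (k - K)%N; rewrite subnKC; last by lia.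
have := tN _ Nk; rewrite ltr_pdivlMr; last by rewrite ltr_wpDl.
move: (t ^+ (k - K)) (exprn_ge0 (k - K) t0) => s s0 sK.
have := f0 K; have := g0 K; have := g0 k => gk gK fK le.
rewrite -(ltr_pM2r gK) (le_lt_trans le)// mulrC ltr_pM2l//.
by apply: le_lt_trans sK; rewrite ler_wpM2l// lerDl.
Qed.

End domination.

(** * The comparisons between the classical families *)

Section classical_laws.
Context {R : realType}.

Let natr_sub_gt0 (k n : nat) : (k < n)%N -> 0 < n%:R - k%:R :> R.
Proof. by move=> kn; rewrite subr_gt0 ltr_nat. Qed.

Lemma st_le_binomial n1 n2 (p1 p2 : R) : 0 < p1 < 1 -> 0 < p2 < 1 ->
  st_le (real_law (binomial_prob n1 p1)) (real_law (binomial_prob n2 p2)) <->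
  (1 - p2) ^+ n2 <= (1 - p1) ^+ n1 /\ (n1 <= n2)%N.
Proof.
move=> p1_01 p2_01; have /andP[p1_gt0 p1_lt1] := p1_01.
have /andP[p2_gt0 p2_lt1] := p2_01.
have p1_01' : 0 <= p1 <= 1 by rewrite !ltW.
have p2_01' : 0 <= p2 <= 1 by rewrite !ltW.
have Pf k := @binomial_prob_set1 R n1 p1 k p1_01'.
have Qg k := @binomial_prob_set1 R n2 p2 k p2_01'.
split=> [PQ|[left n12]].
  split; first by rewrite -!binomial_pmf0; exact: (st_le_head Pf Qg PQ).
  rewrite leqNgt; apply/negP => n21.
  have : binomial_pmf n1 p1 n1 <= binomial_pmf n2 p2 n1.
    apply: (st_le_tail Pf Qg PQ) => k n1k.
    by rewrite !binomial_pmf_eq0//; exact: ltn_trans n1k.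
  by rewrite (binomial_pmf_eq0 _ n21) leNgt binomial_pmf_gt0.
apply: (st_le_crossing Pf Qg) => i j ij.
have [jn1|n1j] := leqP j n1; last first.
  by rewrite (binomial_pmf_eq0 _ n1j) binomial_pmf_ge0.
apply: (@recurrence_crossing _ _ _ (fun=> 1 - p1) (fun k => (n1%:R - k%:R) * p1)
  (fun=> 1 - p2) (fun k => (n2%:R - k%:R) * p2) 0 n2) => //.
- by move=> k; exact: binomial_pmf_ge0.
- by move=> k; exact: binomial_pmf_ge0.
- move=> k /= kn2; rewrite ltr_wpDl ?binomial_pmf_ge0//.
  exact: binomial_pmf_gt0.
- by move=> k; exact: binomial_pmfS.
- by move=> k; exact: binomial_pmfS.
- by move=> k _; rewrite subr_gt0.
- by move=> k _; rewrite subr_gt0.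
- have gf0 : binomial_pmf n2 p2 0 <= binomial_pmf n1 p1 0.
    by rewrite !binomial_pmf0.
  (* If [n1 = n2], no inequality at the right end is given, but after splitting off [n2 - k] the
     increments have constant sign and the left end suffices. If [n1 < n2], the first law has no
     mass at [n2], so both ends are available for the linear [D]. *)
  move=> y /= yn2; move: n12; rewrite leq_eqVlt => /predU1P[n12|n12].
    have DE k : (n2%:R - k%:R) * p2 * (1 - p1) - (n1%:R - k%:R) * p1 * (1 - p2) =
        (n2%:R - k%:R) * (p2 * (1 - p1) - p1 * (1 - p2)) by rewrite n12; ring.
    rewrite DE pmulr_rlt0 ?natr_sub_gt0// => lt0.
    left; split=> // x xy; rewrite DE mulr_ge0_le0 ?(ltW lt0)//.
    by rewrite ltW// natr_sub_gt0//; lia.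
  pose c1 := p1 * (1 - p2) - p2 * (1 - p1).
  pose c0 := n2%:R * p2 * (1 - p1) - n1%:R * p1 * (1 - p2).
  have DE k : (n2%:R - k%:R) * p2 * (1 - p1) - (n1%:R - k%:R) * p1 * (1 - p2) =
      0 * k%:R ^+ 2 + c1 * k%:R + c0 by rewrite /c1 /c0; ring.
  rewrite DE => /(concave_quadratic_one_side (lexx 0))[xle|zle].
    by left; split=> // x xy; rewrite DE xle// ltr_nat.
  right; split=> [|z /andP[yz _]]; last by rewrite DE zle// ltr_nat.
  by rewrite binomial_pmf_eq0 ?binomial_pmf_ge0.
- exact: leq_trans n12.
Qed.

Lemma eventually_lt_negbin (r1 r2 p1 p2 : R) :
  0 < r1 -> 0 < r2 -> 0 < p1 < p2 -> p2 <= 1 ->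
  exists K, forall k, (K <= k)%N -> negbin_pmf r2 p2 k < negbin_pmf r1 p1 k.
Proof.
move=> r1_gt0 r2_gt0 /andP[p1_gt0 p12] p2_le1.
pose q1 := 1 - p1; pose q2 := 1 - p2.
have q2_ge0 : 0 <= q2 by rewrite /q2; lra.
have q12 : q2 < q1 by rewrite /q1 /q2; lra.
have q1_gt0 : 0 < q1 by lra.
(* The growth factors have limiting ratio [q2 / q1], and [t] is the midpoint between this and 1. The
   required bound follows from [r2 * q2 <= k * (q1 - q2) / 2], whence the threshold. *)
pose t := (q1 + q2) / (2 * q1).
have tq1 : t * q1 = (q1 + q2) / 2 by rewrite /t; field; rewrite gt_eqF.
apply: (@eventually_lt_of_ratio _ _ _ (fun k => (r2 + k%:R) * q2)
  (fun k => (r1 + k%:R) * q1) t (Num.truncn (2 * r2 * q2 / (q1 - q2))).+1).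
- by move=> k; rewrite negbin_pmf_ge0// p2_le1 (lt_trans p1_gt0).
- by move=> k; rewrite negbin_pmf_gt0// p1_gt0 (lt_le_trans p12).
- by move=> k; exact: negbin_pmfS.
- by move=> k; exact: negbin_pmfS.
- by rewrite divr_ge0 ?ltr_pdivrMr; lra.
- move=> k; rewrite -(ler_nat R) => Kk.
  have : 2 * r2 * q2 / (q1 - q2) < k%:R by apply: lt_le_trans Kk; exact: truncnS_gt.
  rewrite ltr_pdivrMr ?subr_gt0// mulrCA [t * q1]tq1 => lt.
  have : 0 <= r1 * (q1 + q2) by rewrite mulr_ge0; lra.
  by lra.
Qed.

Lemma st_le_negbin (r1 r2 p1 p2 : R) :
  0 < r1 -> 0 < r2 -> 0 < p1 <= 1 -> 0 < p2 <= 1 ->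
  st_le (real_law (negbin_prob r1 p1)) (real_law (negbin_prob r2 p2)) <->
  p2 `^ r2 <= p1 `^ r1 /\ p2 <= p1.
Proof.
move=> r1_gt0 r2_gt0 p1_01 p2_01.
have /andP[p1_gt0 p1_le1] := p1_01; have /andP[p2_gt0 p2_le1] := p2_01.
have Pf k := @negbin_prob_set1 R r1 p1 k r1_gt0 p1_01.
have Qg k := @negbin_prob_set1 R r2 p2 k r2_gt0 p2_01.
split=> [PQ|[left p21]].
  split; first by rewrite -!negbin_pmf0; exact: (st_le_head Pf Qg PQ).
  rewrite leNgt; apply/negP => p12.
  have p1_12 : 0 < p1 < p2 by rewrite p1_gt0.
  have [K gf] := eventually_lt_negbin r1_gt0 r2_gt0 p1_12 p2_le1.
  have := gf K (leqnn K); rewrite ltNge => /negP; apply.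
  by apply: (st_le_tail Pf Qg PQ) => k Kk; rewrite ltW// gf// ltnW.
apply: (st_le_crossing Pf Qg) => i j ij.
(* For [p2 = 1] both laws are the Dirac measure at 0, and the positivity of masses required below
   fails. *)
have [p2_lt1|p2_ge1] := ltP p2 1; last first.
  have p1_eq1 : p1 = 1 by lra.
  rewrite [negbin_pmf r1 p1 j]/negbin_pmf p1_eq1 subrr expr0n.
  by rewrite gtn_eqF ?mulr0 ?negbin_pmf_ge0//; exact: leq_ltn_trans ij.
(* The supports are unbounded, so the interval is cut at [j]. [D] has slope [p1 - p2 >= 0]: once
   negative, it is nonpositive everywhere before, which contradicts the left end. *)
apply: (@recurrence_crossing _ _ _ (fun=> 1) (fun k => (r1 + k%:R) * (1 - p1))
  (fun=> 1) (fun k => (r2 + k%:R) * (1 - p2)) 0 j) => //.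
- by move=> k; exact: negbin_pmf_ge0.
- by move=> k; exact: negbin_pmf_ge0.
- by move=> k _; rewrite ltr_wpDl ?negbin_pmf_ge0// negbin_pmf_gt0// p2_gt0.
- by move=> k; rewrite mulr1; exact: negbin_pmfS.
- by move=> k; rewrite mulr1; exact: negbin_pmfS.
- move=> y /= _ Dy; left; split; first by rewrite !negbin_pmf0.
  move=> x /= xy; apply: le_trans (ltW Dy); rewrite -subr_ge0.
  rewrite (_ : _ - _ = (y%:R - x%:R) * (p1 - p2)); last by ring.
  by rewrite mulr_ge0 ?subr_ge0// ler_nat ltnW.
Qed.

Lemma st_le_binomial_poisson n (p l : R) m : (1 <= n)%N -> 0 <= p <= 1 -> 0 < l ->
  st_le (real_law (binomial_prob n p)) (real_law (poisson_prob l m)) <->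
  expR (- l) <= (1 - p) ^+ n.
Proof.
move=> n_gt0 p01 l_gt0; have /andP[p_ge0 p_le1] := p01.
have Pf k := @binomial_prob_set1 R n p k p01.
have Qg k := @poisson_prob_set1 R l m k l_gt0.
split=> [PQ|left].
  by rewrite -(binomial_pmf0 n) -poisson_pmf0//; exact: (st_le_head Pf Qg PQ).
(* For [p = 1] the left tail condition would read [expR (- l) <= 0]. *)
have p_lt1 : p < 1.
  rewrite lt_neqAle p_le1 andbT; apply/eqP => p1; move: left.
  by rewrite p1 subrr expr0n gtn_eqF// leNgt expR_gt0.
apply: (st_le_crossing Pf Qg) => i j ij.
apply: (@recurrence_crossing _ _ _ (fun=> 1 - p) (fun k => (n%:R - k%:R) * p)
  (fun=> 1) (fun=> l) 0 j) => //.
- by move=> k; exact: binomial_pmf_ge0.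
- by move=> k; exact: poisson_pmf_ge0.
- by move=> k _; rewrite ltr_wpDl ?binomial_pmf_ge0// poisson_pmf_gt0.
- by move=> k; exact: binomial_pmfS.
- by move=> k; rewrite mulr1; exact: poisson_pmfS.
- by move=> k _; rewrite subr_gt0.
- move=> y /= _ Dy; left; split; first by rewrite binomial_pmf0 poisson_pmf0.
  move=> x /= xy; apply: le_trans (ltW Dy); rewrite -subr_ge0.
  rewrite (_ : _ - _ = (y%:R - x%:R) * p); last by ring.
  by rewrite mulr_ge0 ?subr_ge0// ler_nat ltnW.
Qed.

Lemma limn_esup_binomial_poisson n (p l : R) m : 0 <= p <= 1 -> 0 < l ->
  (limn_esup (fun k : nat =>
    binomial_prob n p [set k] / poisson_prob l m [set k]) <= 1)%E.
Proof.
move=> p01 l_gt0; apply: (@limn_esup_le1 _ _ n.+1) => k nk.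
by rewrite binomial_prob_set1// binomial_pmf_eq0// mul0e lee_fin.
Qed.

(** Here [D k] is [(r + k) * (1 - p) - l], increasing in [k], so a decrease of the ratio always
    conflicts with the left end. *)
Lemma st_le_poisson_negbin (l r p : R) m : 0 < p < 1 -> 0 < r -> 0 < l ->
  st_le (real_law (poisson_prob l m)) (real_law (negbin_prob r p)) <->
  p `^ r <= expR (- l).
Proof.
move=> p01 r_gt0 l_gt0; have /andP[p_gt0 p_lt1] := p01.
have p01' : 0 < p <= 1 by rewrite p_gt0 ltW.
have Pf k := @poisson_prob_set1 R l m k l_gt0.
have Qg k := @negbin_prob_set1 R r p k r_gt0 p01'.
split=> [PQ|left].
  by rewrite -negbin_pmf0 -poisson_pmf0//; exact: (st_le_head Pf Qg PQ).
apply: (st_le_crossing Pf Qg) => i j ij.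
apply: (@recurrence_crossing _ _ _ (fun=> 1) (fun=> l)
  (fun=> 1) (fun k => (r + k%:R) * (1 - p)) 0 j) => //.
- by move=> k; exact: poisson_pmf_ge0.
- by move=> k; exact: negbin_pmf_ge0.
- by move=> k _; rewrite ltr_wpDr ?negbin_pmf_ge0// poisson_pmf_gt0.
- by move=> k; rewrite mulr1; exact: poisson_pmfS.
- by move=> k; rewrite mulr1; exact: negbin_pmfS.
- move=> y /= _ Dy; left; split; first by rewrite negbin_pmf0 poisson_pmf0.
  move=> x /= xy; apply: le_trans (ltW Dy); rewrite -subr_ge0.
  rewrite (_ : _ - _ = (y%:R - x%:R) * (1 - p)); last by ring.
  by rewrite mulr_ge0 ?subr_ge0 ?(ltW p_lt1)// ler_nat ltnW.
Qed.

Lemma limn_esup_poisson_negbin (l r p : R) m : 0 < p < 1 -> 0 < r -> 0 < l ->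
  (limn_esup (fun k : nat =>
    poisson_prob l m [set k] / negbin_prob r p [set k]) <= 1)%E.
Proof.
move=> p01 r_gt0 l_gt0; have /andP[p_gt0 p_lt1] := p01.
have p01' : 0 < p <= 1 by rewrite p_gt0 ltW.
have [K fg] : exists K, forall k, (K <= k)%N -> poisson_pmf l k < negbin_pmf r p k.
  (* The threshold is where [l <= (r + k) * (1 - p) / 2] is guaranteed. *)
  apply: (@eventually_lt_of_ratio _ _ _ (fun=> l) (fun k => (r + k%:R) * (1 - p))
    (1 / 2) (Num.truncn (2 * l / (1 - p))).+1).
  - by move=> k; exact: poisson_pmf_ge0.
  - by move=> k; exact: negbin_pmf_gt0.
  - by move=> k; exact: poisson_pmfS.
  - by move=> k; exact: negbin_pmfS.
  - by apply/andP; split; lra.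
  - move=> k; rewrite -(ler_nat R) => Kk.
    have : 2 * l / (1 - p) < k%:R by apply: lt_le_trans Kk; exact: truncnS_gt.
    rewrite ltr_pdivrMr ?subr_gt0// => lt.
    have : 0 <= r * (1 - p) by rewrite mulr_ge0; lra.
    by lra.
apply: (@limn_esup_le1 _ _ K) => k /fg lt.
have g_gt0 := negbin_pmf_gt0 k r_gt0 p01.
rewrite poisson_prob_set1// negbin_prob_set1// inver gt_eqF// -EFinM lee_fin.
by rewrite ler_pdivrMr// mul1r ltW.
Qed.

(** After the factor [m - k] is split off, the increment is linear with slope -1, so once negative
    it stays so up to the right end [m]. The interval starts at [m - W], where the denominator
    factor of the hypergeometric recurrence becomes positive; a violation cannot begin earlier. *)
Lemma st_le_binomial_hypergeometric B W m (p : R) :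
  (1 <= m <= B + W)%N -> 0 <= p <= 1 ->
  st_le (real_law (binomial_prob m p)) (real_law (hypergeometric_prob B W m)) <->
  p ^+ m <= 'C(B, m)%:R / 'C(B + W, m)%:R.
Proof.
move=> /andP[m_gt0 mBW] p01; have /andP[p_ge0 p_le1] := p01.
have Pf k := @binomial_prob_set1 R m p k p01.
have Qg k := @hypergeometric_prob_set1 R B W m k mBW.
rewrite -hypergeometric_pmf_last -(binomial_pmf_last m p); split=> [PQ|right].
  apply: (st_le_tail Pf Qg PQ) => k mk.
  by rewrite hypergeometric_pmf_eq0 ?binomial_pmf_ge0//; lia.
apply: (st_le_crossing Pf Qg) => i j ij fgi.
have g_gt0 : 0 < @hypergeometric_pmf R B W m i.
  by apply: le_lt_trans fgi; exact: binomial_pmf_ge0.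
have ai : (m - W <= i)%N by move: g_gt0; rewrite hypergeometric_pmf_gt0//; lia.
have [mj|] := ltnP m j; first by rewrite binomial_pmf_eq0// hypergeometric_pmf_ge0.
rewrite leq_eqVlt => /predU1P[->//|jm].
move: p_ge0; rewrite le_eqVlt => /predU1P[p0|p_gt0].
  rewrite binomial_pmfE -p0 expr0n gtn_eqF ?(leq_ltn_trans _ ij)//.
  by rewrite mul0r mulr0 hypergeometric_pmf_ge0.
move: p_le1; rewrite le_eqVlt => /predU1P[p1|p_lt1].
  rewrite binomial_pmfE p1 subrr expr0n gtn_eqF ?subn_gt0//.
  by rewrite !mulr0 hypergeometric_pmf_ge0.
move: fgi; apply: (@recurrence_crossing _ _ _
  (fun=> 1 - p) (fun k => (m%:R - k%:R) * p)
  (fun k => W%:R + k.+1%:R - m%:R) (fun k => (B%:R - k%:R) * (m%:R - k%:R))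
  (m - W) m) => //.
- by move=> k; exact: binomial_pmf_ge0.
- by move=> k; exact: hypergeometric_pmf_ge0.
- move=> k /andP[_ km]; rewrite ltr_pwDl ?hypergeometric_pmf_ge0//.
  by rewrite binomial_pmf_gt0// p_gt0.
- by move=> k; exact: binomial_pmfS.
- by move=> k; exact: hypergeometric_pmfS.
- by move=> k _; rewrite subr_gt0.
- by move=> k /andP[ak _]; rewrite subr_gt0 -natrD ltr_nat; lia.
- move=> y /= /andP[_ ym].
  pose L k := (B%:R - k%:R) * (1 - p) - p * (W%:R + k.+1%:R - m%:R).
  have DE k : (B%:R - k%:R) * (m%:R - k%:R) * (1 - p) -
      (m%:R - k%:R) * p * (W%:R + k.+1%:R - m%:R) = (m%:R - k%:R) * L k.
    by rewrite /L; ring.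
  rewrite DE pmulr_rlt0 ?natr_sub_gt0// => Ly.
  right; split=> // z /andP[yz zm].
  rewrite DE pmulr_rle0 ?natr_sub_gt0// (le_trans _ (ltW Ly))// -subr_ge0.
  rewrite (_ : _ - _ = z%:R - y%:R); last first.
    by rewrite /L -(natr1 z) -(natr1 y); ring.
  by rewrite subr_ge0 ler_nat ltnW.
- exact: ltnW.
Qed.

(** The right tail condition already gives the stochastic order, and the order forces the inequality
    at the least point of the joint support. *)
Lemma binomial_hypergeometric_left_tail B W m (p : R) :
  (1 <= m <= B + W)%N -> 0 <= p <= 1 ->
  p ^+ m <= 'C(B, m)%:R / 'C(B + W, m)%:R ->
  exists2 k : nat,
    is_least (law_support
      (measure_add (binomial_prob m p) (hypergeometric_prob B W m))) k &
    (hypergeometric_prob B W m [set k] <= binomial_prob m p [set k])%E.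
Proof.
move=> mBW1 p01 /(st_le_binomial_hypergeometric mBW1 p01) PQ.
have /andP[m_gt0 mBW] := mBW1.
have Pf k := @binomial_prob_set1 R m p k p01.
have Qg k := @hypergeometric_prob_set1 R B W m k mBW.
pose f := binomial_pmf m p; pose g := @hypergeometric_pmf R B W m.
have f0 k : 0 <= f k by exact: binomial_pmf_ge0.
have g0 k : 0 <= g k by exact: hypergeometric_pmf_ge0.
have suppE k : law_support
    (measure_add (binomial_prob m p) (hypergeometric_prob B W m)) k =
    (0 < f k + g k) :> Prop.
  by rewrite -lte_fin EFinD -Pf -Qg /law_support /= measure_addE.
have ex_supp : exists k, 0 < f k + g k.
  exists (m - W)%N; rewrite ltr_wpDl// hypergeometric_pmf_gt0//; lia.
case: (ex_minnP ex_supp) => k fgk kmin; exists k.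
  by split; [rewrite suppE|move=> l; rewrite suppE; exact: kmin].
rewrite Pf Qg lee_fin; apply: (st_le_head Pf Qg PQ) => l lk.
suff : f l <= 0 by move/le_trans; apply; exact: g0.
have : ~~ (0 < f l + g l) by apply/negP => /kmin; rewrite leqNgt lk.
by rewrite -leNgt; have := g0 l; lra.
Qed.

Lemma st_le_hypergeometric_binomial B W m n (p : R) :
  (m <= B + W)%N -> 0 < p <= 1 ->
  st_le (real_law (hypergeometric_prob B W m)) (real_law (binomial_prob n p)) <->
  (1 - p) ^+ n <= 'C(W, m)%:R / 'C(B + W, m)%:R /\ (minn m B <= n)%N.
Proof.
move=> mBW /andP[p_gt0 p_le1].
have p01 : 0 <= p <= 1 by rewrite ltW.
have Pf k := @hypergeometric_prob_set1 R B W m k mBW.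
have Qg k := @binomial_prob_set1 R n p k p01.
rewrite -hypergeometric_pmf0 -(binomial_pmf0 n p).
split=> [PQ|[left mBn]].
  split; first exact: (st_le_head Pf Qg PQ).
  rewrite leqNgt; apply/negP => nmB.
  have : hypergeometric_pmf B W m (minn m B) <= binomial_pmf n p (minn m B).
    apply: (st_le_tail Pf Qg PQ) => k mBk.
    by rewrite binomial_pmf_eq0 ?hypergeometric_pmf_ge0//; lia.
  by rewrite (binomial_pmf_eq0 _ nmB) leNgt hypergeometric_pmf_gt0//; lia.
apply: (st_le_crossing Pf Qg) => i j ij fgi.
have hyp_eq0 k : (minn m B < k)%N -> hypergeometric_pmf B W m k = 0 :> R.
  by move=> mBk; rewrite hypergeometric_pmf_eq0//; lia.
have [nj|jn] := ltnP n j.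
  by rewrite hyp_eq0 ?binomial_pmf_ge0//; exact: leq_ltn_trans nj.
move: p_le1; rewrite le_eqVlt => /predU1P[p1|p_lt1].
  move: fgi; rewrite binomial_pmfE p1 subrr expr0n gtn_eqF; last first.
    by rewrite subn_gt0; exact: leq_trans jn.
  by rewrite !mulr0 ltNge hypergeometric_pmf_ge0.
(* For [p < 1] the left tail condition makes the hypergeometric mass at 0 positive. Hence [m <= W],
   and the denominator factor is positive from [k = 0] on. *)
have mW : (m <= W)%N.
  have : 0 < @hypergeometric_pmf R B W m 0.
    by apply: lt_le_trans left; rewrite binomial_pmf_gt0// p_gt0.
  by rewrite hypergeometric_pmf_gt0//; lia.
move: fgi; apply: (@recurrence_crossing _ _ _
  (fun k => W%:R + k.+1%:R - m%:R) (fun k => (B%:R - k%:R) * (m%:R - k%:R))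
  (fun=> 1 - p) (fun k => (n%:R - k%:R) * p) 0 n) => //.
- by move=> k; exact: hypergeometric_pmf_ge0.
- by move=> k; exact: binomial_pmf_ge0.
- move=> k /= kn; rewrite ltr_wpDl ?hypergeometric_pmf_ge0//.
  by rewrite binomial_pmf_gt0// p_gt0.
- by move=> k; exact: hypergeometric_pmfS.
- by move=> k; exact: binomial_pmfS.
- by move=> k _; rewrite subr_gt0 -natrD ltr_nat; lia.
- by move=> k _; rewrite subr_gt0.
(* If [minn m B = n], the factor [n - k] is common to both products, and the cofactor [L] has slope
   1, so the left end suffices. Otherwise the first law has no mass at [n], and [D] is quadratic
   with leading coefficient [- p - (1 - p) = -1]. *)
move=> y /= yn; move: mBn; rewrite leq_eqVlt => /predU1P[mBn|mBn].
  pose L k := p * (W%:R + k.+1%:R - m%:R) - (maxn m B)%:R * (1 - p) + k%:R * (1 - p).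
  have DE k : (n%:R - k%:R) * p * (W%:R + k.+1%:R - m%:R) -
      (B%:R - k%:R) * (m%:R - k%:R) * (1 - p) = (n%:R - k%:R) * L k.
    rewrite /L; move: mBn; rewrite /minn /maxn.
    by case: ifP => _ <-; ring.
  rewrite DE pmulr_rlt0 ?natr_sub_gt0// => Ly.
  left; split=> // x xy.
  rewrite DE pmulr_rle0 ?natr_sub_gt0//; last exact: ltn_trans yn.
  rewrite (le_trans _ (ltW Ly))// -subr_ge0.
  rewrite (_ : _ - _ = y%:R - x%:R); last first.
    by rewrite /L -(natr1 x) -(natr1 y); ring.
  by rewrite subr_ge0 ler_nat ltnW.
pose w : R := W%:R + 1 - m%:R.
pose c1 := p * (n%:R - w) + (1 - p) * (B%:R + m%:R).
pose c0 := n%:R * p * w - B%:R * m%:R * (1 - p).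
have DE k : (n%:R - k%:R) * p * (W%:R + k.+1%:R - m%:R) -
    (B%:R - k%:R) * (m%:R - k%:R) * (1 - p) =
    -1 * k%:R ^+ 2 + c1 * k%:R + c0 by rewrite /c1 /c0 /w -natr1; ring.
have c2_le0 : -1 <= 0 :> R by lra.
rewrite DE => /(concave_quadratic_one_side c2_le0)[xle|zle].
  by left; split=> // x xy; rewrite DE xle// ltr_nat.
right; split=> [|z /andP[yz _]]; last by rewrite DE zle// ltr_nat.
by rewrite hyp_eq0 ?binomial_pmf_ge0.
Qed.

(* This has the sign of [g k.+1 * f k - f k.+1 * g k], where [f] and [g] are
   the mass functions of hyp(B1, W1, n1) and hyp(B2, W2, n2). *)
Definition hypergeometric_increment B1 W1 n1 B2 W2 n2 (k : nat) : R :=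
  (B2%:R - k%:R) * (n2%:R - k%:R) * (W1%:R + k.+1%:R - n1%:R) -
  (B1%:R - k%:R) * (n1%:R - k%:R) * (W2%:R + k.+1%:R - n2%:R).

(** The factor [F] need only be positive on the steps of the crossing argument; it holds a common
    linear factor or is constantly 1. *)
Definition concave_increments B1 W1 n1 B2 W2 n2 : Prop :=
  exists (F : nat -> R) (c2 c1 c0 : R), c2 <= 0 /\
    forall k, (n1 - W1 <= k < minn n2 B2)%N -> 0 < F k /\
      hypergeometric_increment B1 W1 n1 B2 W2 n2 k =
        F k * (c2 * k%:R ^+ 2 + c1 * k%:R + c0).

(* Either the quadratic coefficient is the difference of the population sizes,
   or a common zero of the two products splits off. *)
Lemma hypergeometric_increments_concave B1 W1 n1 B2 W2 n2 :
  (n1 <= B1 + W1)%N -> (n2 <= B2 + W2)%N ->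
  (B1 + W1 <= B2 + W2)%N \/
    [set n1%:Z; B1%:Z; n2%:Z - W2%:Z - 1] `&`
    [set n2%:Z; B2%:Z; n1%:Z - W1%:Z - 1] !=set0 ->
  concave_increments B1 W1 n1 B2 W2 n2.
Proof.
move=> n1_le n2_le cond.
pose w1 : R := W1%:R + 1 - n1%:R; pose w2 : R := W2%:R + 1 - n2%:R.
have linear_factor (F : nat -> R) (a b : R) :
    (forall k, (n1 - W1 <= k < minn n2 B2)%N -> 0 < F k /\
      (B2%:R - k%:R) * (n2%:R - k%:R) * (w1 + k%:R) -
      (B1%:R - k%:R) * (n1%:R - k%:R) * (w2 + k%:R) = F k * (b * k%:R + a)) ->
  concave_increments B1 W1 n1 B2 W2 n2.
  move=> H; exists F, 0, b, a; split=> // k /H[F0 E]; split=> //.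
  by rewrite /hypergeometric_increment mul0r add0r -E /w1 /w2 -natr1; ring.
have split_off c (A A' : nat) : (minn n2 B2 <= c)%N -> (forall k : nat,
    (B2%:R - k%:R) * (n2%:R - k%:R) = (c%:R - k%:R) * (A%:R - k%:R) :> R) ->
    (forall k : nat,
    (B1%:R - k%:R) * (n1%:R - k%:R) = (c%:R - k%:R) * (A'%:R - k%:R) :> R) ->
  concave_increments B1 W1 n1 B2 W2 n2.
  move=> cb E2 E1; apply: (linear_factor (fun k => c%:R - k%:R)
    (A%:R * w1 - A'%:R * w2) (A%:R - w1 - A'%:R + w2)) => k akb.
  split; first by apply: natr_sub_gt0; lia.
  by rewrite E2 E1; ring.
(* Four of the nine possible coincidences contradict [n1 <= B1 + W1], [n2 <= B2 + W2] or the signs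
   of [W1], [W2]. Four others split off [c - k]; in the last one the two denominator factors
   agree. *)
case: cond => [N12|[z [/= [[->|->]|->] /= [[]|]]]]; try lia.
- exists (fun=> 1), ((B1 + W1)%:R - (B2 + W2)%:R).
  exists (B2%:R * n2%:R - (B2%:R + n2%:R) * w1
    - (B1%:R * n1%:R - (B1%:R + n1%:R) * w2)).
  exists (B2%:R * n2%:R * w1 - B1%:R * n1%:R * w2).
  split=> [|k _]; first by rewrite subr_le0 ler_nat.
  split=> //.
  by rewrite /hypergeometric_increment /w1 /w2 -natr1 !natrD; ring.
- move=> [E]; apply: (split_off n1 B2 B1); first by lia.
    by move=> k; rewrite E mulrC.
  by move=> k; rewrite mulrC.
- move=> [E]; apply: (split_off n1 n2 B1); first by lia.
    by move=> k; rewrite E.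
  by move=> k; rewrite mulrC.
- move=> [E]; apply: (split_off B1 B2 n1); first by lia.
    by move=> k; rewrite E mulrC.
  by [].
- move=> [E]; apply: (split_off B1 n2 n1); first by lia.
    by move=> k; rewrite E.
  by [].
move=> E; have w12 : w1 = w2.
  have : (n2 + W1 = n1 + W2)%N by lia.
  by move/(congr1 (fun n => n%:R : R)); rewrite !natrD /w1 /w2; lra.
apply: (linear_factor (fun k => w1 + k%:R) (B2%:R * n2%:R - B1%:R * n1%:R)
  (B1%:R + n1%:R - (B2%:R + n2%:R))) => k akb.
split; last by rewrite -w12; ring.
have : n1%:R < (W1 + k.+1)%:R :> R by rewrite ltr_nat; lia.
by rewrite natrD -natr1 /w1; lra.
Qed.

(** For sufficiency, the tail conditions first order the endpoints of the supports: otherwise, at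
    [kmin] or [kmax], the mass that should be larger would be 0 and the other positive. So the
    crossing argument runs from [n1 - W1] to [minn n2 B2]. *)
Lemma st_le_hypergeometric B1 W1 n1 B2 W2 n2 :
  (1 <= n1 <= B1 + W1)%N -> (1 <= n2 <= B2 + W2)%N ->
  (B1 + W1 <= B2 + W2)%N \/
    [set n1%:Z; B1%:Z; n2%:Z - W2%:Z - 1] `&`
    [set n2%:Z; B2%:Z; n1%:Z - W1%:Z - 1] !=set0 ->
  let P1 : probability nat R := hypergeometric_prob B1 W1 n1 in
  let P2 : probability nat R := hypergeometric_prob B2 W2 n2 in
  let kmin := minn (n1 - W1) (n2 - W2) in
  let kmax := maxn (minn n1 B1) (minn n2 B2) in
  st_le (real_law P1) (real_law P2) <->
    (P1 [set kmin] >= P2 [set kmin])%E /\ (P1 [set kmax] <= P2 [set kmax])%E.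
Proof.
move=> /andP[_ n1_le] /andP[_ n2_le] cond P1 P2 kmin kmax.
have Pf k := @hypergeometric_prob_set1 R B1 W1 n1 k n1_le.
have Qg k := @hypergeometric_prob_set1 R B2 W2 n2 k n2_le.
pose f := @hypergeometric_pmf R B1 W1 n1.
pose g := @hypergeometric_pmf R B2 W2 n2.
have f0 k : 0 <= f k by exact: hypergeometric_pmf_ge0.
have g0 k : 0 <= g k by exact: hypergeometric_pmf_ge0.
have -> : (P2 [set kmin] <= P1 [set kmin])%E = (g kmin <= f kmin).
  by rewrite -lee_fin -Pf -Qg.
have -> : (P1 [set kmax] <= P2 [set kmax])%E = (f kmax <= g kmax).
  by rewrite -lee_fin -Pf -Qg.
split=> [PQ|[left right]].
  split.
    apply: (st_le_head Pf Qg PQ) => k klt.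
    by rewrite !hypergeometric_pmf_eq0//; rewrite /kmin in klt; lia.
  apply: (st_le_tail Pf Qg PQ) => k klt.
  by rewrite !hypergeometric_pmf_eq0//; rewrite /kmax in klt; lia.
have f_gt0 k : (0 < f k) = (n1 - W1 <= k <= minn B1 n1)%N.
  exact: hypergeometric_pmf_gt0.
have g_gt0 k : (0 < g k) = (n2 - W2 <= k <= minn B2 n2)%N.
  exact: hypergeometric_pmf_gt0.
have a12 : (n1 - W1 <= n2 - W2)%N.
  rewrite leqNgt; apply/negP => a21.
  have : 0 < f kmin by apply: lt_le_trans left; rewrite g_gt0 /kmin; lia.
  by rewrite f_gt0 /kmin; lia.
have b12 : (minn n1 B1 <= minn n2 B2)%N.
  rewrite leqNgt; apply/negP => b21.
  have : 0 < g kmax by apply: lt_le_trans right; rewrite f_gt0 /kmax; lia.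
  by rewrite g_gt0 /kmax; lia.
apply: (st_le_crossing Pf Qg) => i j ij fgi; rewrite -/(f j) -/(g j).
rewrite leNgt; apply/negP => gfj.
(* A violation has [n2 - W2 <= i < j <= minn n1 B1], so the supports overlap and leave no massless
   gap between the endpoints. *)
have : 0 < g i by exact: le_lt_trans fgi.
have : 0 < f j by exact: le_lt_trans gfj.
rewrite f_gt0 g_gt0 => jb1 ia2; move: gfj; apply/negP; rewrite -leNgt.
have [F [c2 [c1 [c0 [c2_le0 DE]]]]] :=
  hypergeometric_increments_concave n1_le n2_le cond.
have u1_gt0 k : (n1 - W1 <= k)%N -> 0 < W1%:R + k.+1%:R - n1%:R :> R.
  by move=> ak; rewrite subr_gt0 -natrD ltr_nat; lia.
have u2_gt0 k : (n2 - W2 <= k)%N -> 0 < W2%:R + k.+1%:R - n2%:R :> R.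
  by move=> ak; rewrite subr_gt0 -natrD ltr_nat; lia.
pose D : nat -> R := hypergeometric_increment B1 W1 n1 B2 W2 n2.
have signD k : (n2 - W2 <= k)%N -> (f k.+1 * g k < g k.+1 * f k -> 0 < D k) /\
    (g k.+1 * f k < f k.+1 * g k -> D k < 0).
  move=> ak; apply: (@ratio_sign _ k.+1%:R); rewrite ?ltr0n ?u2_gt0//.
  - by apply: u1_gt0; lia.
  - exact: hypergeometric_pmfS.
  - exact: hypergeometric_pmfS.
apply: (@ratio_crossing _ f g D (n1 - W1) (minn n2 B2) i j) => //; try lia.
- move=> k kab; have [kb1|kb1] := leqP k (minn n1 B1).
    by rewrite ltr_pwDl// f_gt0; lia.
  by rewrite ltr_wpDl// g_gt0; lia.
(* Below [n2 - W2] the factor [W2 + k.+1 - n2] is not positive and [ratio_sign] does not apply. An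
   increase there needs [g k.+1 > 0], so [k.+1 = n2 - W2]; the factor is then 0 and [D k] reduces to
   its positive first product. *)
- move=> k kab lt; have [ka2|ka2] := leqP (n2 - W2) k.
    by have [+ _] := signD k ka2; apply.
  have : 0 < g k.+1 * f k by apply: le_lt_trans lt; rewrite mulr_ge0.
  have [gk1|] := ltP 0 (g k.+1); last by move=> gk; rewrite ltNge mulr_le0_ge0.
  move: gk1; rewrite g_gt0 => kS _.
  have -> : D k = (B2%:R - k%:R) * (n2%:R - k%:R) * (W1%:R + k.+1%:R - n1%:R).
    rewrite /D /hypergeometric_increment; have -> : W2%:R + k.+1%:R - n2%:R = 0 :> R.
      by rewrite -natrD; apply/eqP; rewrite subr_eq0 eqr_nat; lia.
    by rewrite mulr0 subr0.
  by rewrite !mulr_gt0 ?natr_sub_gt0 ?u1_gt0//; lia.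
- move=> k kab lt.
  have gk : 0 < g k.
    rewrite lt_neqAle g0 andbT eq_sym; apply/eqP => gk; move: lt.
    by rewrite gk mulr0 ltNge mulr_ge0.
  have ka2 : (n2 - W2 <= k)%N by move: gk; rewrite g_gt0; lia.
  by have [_ +] := signD k ka2; apply.
move=> y yab; have [Fy Ey] := DE y yab.
rewrite /D Ey pmulr_rlt0// => /(concave_quadratic_one_side c2_le0)[xle|zle].
  left; split; first by move: left; rewrite /kmin; congr (g _ <= f _); lia.
  move=> x xy; have [|Fx ->] := DE x; first by lia.
  by rewrite pmulr_rle0// xle// ltr_nat; lia.
right; split; first by move: right; rewrite /kmax; congr (f _ <= g _); lia.
move=> z yz; have [|Fz ->] := DE z; first by lia.
by rewrite pmulr_rle0// zle// ltr_nat; lia.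
Qed.

End classical_laws.

Theorem theorem1 (R : realType) :
  (* (a) *)
  (forall (n1 n2 : nat) (p1 p2 : R),
    (1 <= n1)%N -> (1 <= n2)%N -> 0 < p1 < 1 -> 0 < p2 < 1 ->
    let P1 : probability nat R := binomial_prob n1 p1 in
    let P2 : probability nat R := binomial_prob n2 p2 in
    st_le (real_law P1) (real_law P2) <->
      (1 - p1) ^+ n1 >= (1 - p2) ^+ n2 /\ (n1 <= n2)%N) /\
  (* (b) *)
  (forall r1 r2 p1 p2 : R,
    0 < r1 -> 0 < r2 -> 0 < p1 <= 1 -> 0 < p2 <= 1 ->
    let P1 : probability nat R := negbin_prob r1 p1 in
    let P2 : probability nat R := negbin_prob r2 p2 in
    st_le (real_law P1) (real_law P2) <->
      p1 `^ r1 >= p2 `^ r2 /\ p1 >= p2) /\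
  (* (c); the two three-element sets are sets of integers *)
  (forall B1 W1 n1 B2 W2 n2 : nat,
    (1 <= n1 <= B1 + W1)%N -> (1 <= n2 <= B2 + W2)%N ->
    (B1 + W1 <= B2 + W2)%N \/
      [set n1%:Z; B1%:Z; n2%:Z - W2%:Z - 1] `&`
      [set n2%:Z; B2%:Z; n1%:Z - W1%:Z - 1] !=set0 ->
    let P1 : probability nat R := hypergeometric_prob B1 W1 n1 in
    let P2 : probability nat R := hypergeometric_prob B2 W2 n2 in
    let kmin := minn (n1 - W1) (n2 - W2) in
    let kmax := maxn (minn n1 B1) (minn n2 B2) in
    st_le (real_law P1) (real_law P2) <->
      (P1 [set kmin] >= P2 [set kmin])%E /\ (P1 [set kmax] <= P2 [set kmax])%E) /\
  (* (d) *)
  (forall (B W m n : nat) (p : R),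
    (1 <= B)%N -> (1 <= W)%N -> (1 <= m)%N -> (1 <= n)%N ->
    (m <= B + W)%N -> 0 < p <= 1 ->
    let P1 : probability nat R := hypergeometric_prob B W m in
    let P2 : probability nat R := binomial_prob n p in
    st_le (real_law P1) (real_law P2) <->
      'C(W, m)%:R / 'C(B + W, m)%:R >= (1 - p) ^+ n /\ (minn m B <= n)%N) /\
  (* (e) *)
  (forall (B W m : nat) (p : R),
    (1 <= m <= B + W)%N -> 0 <= p <= 1 ->
    let P1 : probability nat R := binomial_prob m p in
    let P2 : probability nat R := hypergeometric_prob B W m in
    (st_le (real_law P1) (real_law P2) <->
      p ^+ m <= 'C(B, m)%:R / 'C(B + W, m)%:R) /\
    (p ^+ m <= 'C(B, m)%:R / 'C(B + W, m)%:R ->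
      exists2 k : nat, is_least (law_support (measure_add P1 P2)) k &
        (P1 [set k] >= P2 [set k])%E)) /\
  (* (f); the nat argument of poisson_prob is unused by the library *)
  (forall (n : nat) (p lambda : R),
    (1 <= n)%N -> 0 <= p <= 1 -> 0 < lambda ->
    let P1 : probability nat R := binomial_prob n p in
    let P2 : probability nat R := poisson_prob lambda 0 in
    (st_le (real_law P1) (real_law P2) <-> (1 - p) ^+ n >= expR (- lambda)) /\
    (limn_esup (fun k : nat => P1 [set k] / P2 [set k]) <= 1)%E) /\
  (* (g) *)
  (forall lambda r p : R,
    0 < p < 1 -> 0 < r -> 0 < lambda ->
    let P1 : probability nat R := poisson_prob lambda 0 in
    let P2 : probability nat R := negbin_prob r p in
    (st_le (real_law P1) (real_law P2) <-> expR (- lambda) >= p `^ r) /\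
    (limn_esup (fun k : nat => P1 [set k] / P2 [set k]) <= 1)%E).
Proof.
split; first by move=> n1 n2 p1 p2 _ _; exact: st_le_binomial.
split; first exact: st_le_negbin.
split; first exact: st_le_hypergeometric.
split; first by move=> B W m n p _ _ _ _; exact: st_le_hypergeometric_binomial.
split.
  move=> B W m p mBW p01; split; first exact: st_le_binomial_hypergeometric.
  exact: binomial_hypergeometric_left_tail.
split=> [n p l n_gt0 p01 l_gt0|l r p p01 r_gt0 l_gt0]; split.
- exact: st_le_binomial_poisson.
- exact: limn_esup_binomial_poisson.
- exact: st_le_poisson_negbin.
- exact: limn_esup_poisson_negbin.
Qed.
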